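(* Let $\beta>0$, let $\Delta^w$ be the weighted Laplacian matrix defined in the context, let $\theta$ satisfy $$0<\theta<\frac{1}{\beta\,\|\Delta^w\|_\infty},$$ and let $A=I-\beta\theta\Delta^w$. Let $E$ and $F$ define the splitting $A=E-F$ with $$E=I,\qquad F=\beta\theta\Delta^w .$$ Then the spectral radius satisfies $\rho(E^{-1}F)<1$, and for each right-hand side $B\in\mathbb{R}^{N^2}$ the iterative method $$X^{(m+1)}=F X^{(m)}+B,\qquad m=0,1,\dots$$ (from any starting vector $X^{(0)}\in\mathbb{R}^{N^2}$) converges to the solution of the linear system $AX=B$.
   Context: Let $N\ge 2$. Images $u\in\mathbb{R}^{N\times N}$ are identified with vectors in $\mathbb{R}^{N^2}$ by $k=(i-1)N+j$. The discrete gradient $Du=(u_x,u_y)$ is given by backward differences, $(u_x)_k=u_k-u_{k-1}$ and $(u_y)_k=u_k-u_{k-N}$ at interior pixels, with a fixed linear convention at the boundary pixels, so that $u\mapsto u_x$ and $u\mapsto u_y$ are linear maps on $\mathbb{R}^{N^2}$. For $\mu>0$ let $\psi_\mu(t)=\frac{1}{\log 2}\log\left(\frac{2}{1+e^{-|t|/\mu}}\right)$; for $t\ge 0$, $\psi_\mu'(t)$ denotes its derivative (one-sided at $t=0$), i.e. $\psi'_\mu(t)=\frac{1}{\mu\log 2\,(1+e^{t/\mu})}>0$. The weights $w^x_{i,j},w^y_{i,j}>0$ are either all equal to $1$ (initialization) or given by $w^x_{i,j}=\psi'_\mu(|\bar u_x|_{i,j})$, $w^y_{i,j}=\psi'_\mu(|\bar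 u_y|_{i,j})$ for some fixed $\mu>0$ and some fixed image $\bar u\in\mathbb{R}^{N\times N}$. The weighted difference matrices $\nabla_x^w,\nabla_y^w\in\mathbb{R}^{N^2\times N^2}$ are defined by $(\nabla_x^w u)_{i,j}=w^x_{i,j}(u_x)_{i,j}$ and $(\nabla_y^w u)_{i,j}=w^y_{i,j}(u_y)_{i,j}$, and $$\Delta^w=-\left((\nabla_x^w)^T\nabla_x^w+(\nabla_y^w)^T\nabla_y^w\right).$$ $\|\cdot\|_\infty$ denotes the matrix norm equal to the maximum absolute row sum, and $I$ the identity matrix of order $N^2$. *)

(* Defs.v *)
From mathcomp Require Import all_boot all_order all_algebra.
From mathcomp Require Import complex ring.
From mathcomp Require Import all_classical all_reals all_analysis.

Set Implicit Arguments.
Unset Strict Implicit.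
Unset Printing Implicit Defensive.

Import Order.TTheory GRing.Theory Num.Theory.
Import numFieldNormedType.Exports.

Local Open Scope classical_set_scope.
Local Open Scope ring_scope.

Definition psi (R : realType) (mu t : R) : R :=
  (ln 2)^-1 * ln (2 / (1 + expR (- `|t| / mu))).

(* psi mu is even with a kink at 0, hence the one-sided derivative there. *)
Definition dpsi (R : realType) (mu t : R) : R :=
  if t == 0 then lim (h^-1 *: (psi mu h - psi mu 0) @[h --> 0^'+])
  else derive1 (psi mu) t.

Section dpsi_formula.
Variables (R : realType) (mu : R).
Hypothesis mu0 : 0 < mu.

(* psi mu without the absolute value: smooth, equal to psi mu on t >= 0. *)
Let g (t : R) : R := (ln 2)^-1 * ln (2 / (1 + expR (- t / mu))).

Let formula (t : R) : R := (mu * ln 2 * (1 + expR (t / mu)))^-1.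

Let is_derive_g (t : R) : is_derive t 1 g (formula t).
Proof.
have l2 : 0 < ln (2 : R) by rewrite ln_gt0// ltr1n.
have e0 x : 0 < 1 + expR (- x / mu) :> R by rewrite addr_gt0// expR_gt0.
have gE : g = (fun x => 1 - (ln 2)^-1 * ln (1 + expR (- x / mu))).
  apply/funext => x; rewrite /g ln_div ?posrE// mulrBr mulVf//.
  by rewrite gt_eqF.
rewrite gE.
have d1 : is_derive t 1 (fun x : R => - x / mu) (- mu^-1).
  have -> : (fun x : R => - x / mu) = (- mu^-1) \*: (@id R).
    by apply/funext => x /=; rewrite /GRing.scale/= mulNr mulrC mulNr.
  by apply: is_derive_eq; rewrite /GRing.scale/= mulr1.
have d2 : is_derive t 1 (fun x : R => 1 + expR (- x / mu))
    (- mu^-1 * expR (- t / mu)).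
  have -> : (fun x : R => 1 + expR (- x / mu)) =
      cst 1 + (expR \o (fun x : R => - x / mu)) by apply/funext.
  have dc := @is_derive1_comp R expR (fun x => - x / mu) t _ _
    (is_derive_expR (- t / mu)) d1.
  by apply: is_derive_eq; rewrite add0r mulrC.
have d3 := @is_derive1_comp R (@ln R) (fun x => 1 + expR (- x / mu)) t _ _
    (is_derive1_ln (e0 t)) d2.
have -> : (fun x => 1 - (ln 2)^-1 * ln (1 + expR (- x / mu))) =
   cst 1 - (ln 2)^-1 \*: (@ln R \o (fun x : R => 1 + expR (- x / mu))).
  by apply/funext.
apply: is_derive_eq; rewrite sub0r /GRing.scale/= /formula mulNr expRN.
have m0 : mu != 0 by rewrite gt_eqF.
have := expR_gt0 (t / mu); move: (expR _) => e e_gt0.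
field.
by rewrite m0 !gt_eqF//= addr_gt0.
Qed.

Let psi_g (t : R) : 0 <= t -> psi mu t = g t.
Proof. by move=> t0; rewrite /psi ger0_norm. Qed.

Lemma dpsiE (t : R) : 0 <= t ->
  dpsi mu t = (mu * ln 2 * (1 + expR (t / mu)))^-1.
Proof.
rewrite /dpsi le_eqVlt eq_sym; case: eqVneq => /= [-> _|_ t0].
  have [dg dgE] := is_derive_g 0.
  rewrite -[RHS]/(formula 0) -dgE; apply: cvg_lim => //.
  have /cvg_dnbhs_at_right := dg.
  apply: cvg_trans; apply: near_eq_cvg; near=> h.
  have h0 : 0 < h by near: h; exact: nbhs_right_gt.
  rewrite (psi_g (ltW h0)) psi_g//.
  by rewrite /GRing.scale/= mulr1 addr0.
have [_ dE] := is_derive_g t.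
rewrite -[RHS]/(formula t) derive1E -dE.
apply: near_eq_derive; near=> x; apply/psi_g/ltW.
by near: x; exact: lt_nbhsr.
Unshelve. all: by end_near. Qed.

Lemma dpsi_gt0 (t : R) : 0 <= t -> 0 < dpsi mu t.
Proof.
move=> t0; rewrite dpsiE// invr_gt0 !mulr_gt0// ?addr_gt0 ?expR_gt0//.
by rewrite ln_gt0// ltr1n.
Qed.

End dpsi_formula.

(* Maximum absolute row sum; matrices in the library carry the entrywise sup
   norm, which is a different one. *)
Definition mxnorm_inf (R : realType) (n : nat) (A : 'M[R]_n) : R :=
  \big[Num.max/0]_(i < n) \sum_(j < n) `|A i j|.

Definition spectral_radius (R : realType) (n : nat) (A : 'M[R]_n) : R :=
  sup [set complex.Re `|z| | z in
        [set z : R[i] | eigenvalue (map_mx (real_complex R) A) z]].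

(* With 0-based indices, pixel (i, j) of an N x N image is k = i * N + j, so
   that i = k %/ N and j = k %% N. *)
Definition interior_pixel (N : nat) (k : 'I_(N ^ 2)) : bool :=
  (0 < k %/ N < N.-1)%N && (0 < k %% N < N.-1)%N.

(* Dx and Dy are the matrices of u |-> u_x and u |-> u_y; their rows at the
   boundary pixels are arbitrary, i.e. any linear convention is allowed. *)
Definition discrete_gradient (R : realType) (N : nat)
    (Dx Dy : 'M[R]_(N ^ 2)) : Prop :=
  forall (u : 'cV[R]_(N ^ 2)) (k l : 'I_(N ^ 2)), interior_pixel k ->
    ((l + 1 = k)%N -> (Dx *m u) k 0 = u k 0 - u l 0) /\
    ((l + N = k)%N -> (Dy *m u) k 0 = u k 0 - u l 0).

Definition admissible_weights (R : realType) (N : nat)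
    (Dx Dy : 'M[R]_(N ^ 2)) (wx wy : 'I_(N ^ 2) -> R) : Prop :=
  (forall k, wx k = 1 /\ wy k = 1) \/
  exists (mu : R) (ubar : 'cV[R]_(N ^ 2)), 0 < mu /\
    forall k, wx k = dpsi mu `|(Dx *m ubar) k 0| /\
              wy k = dpsi mu `|(Dy *m ubar) k 0|.

Definition weighted_diff (R : realType) (n : nat) (w : 'I_n -> R)
    (D : 'M[R]_n) : 'M[R]_n := \matrix_(k, l) (w k * D k l).

Lemma weighted_diffE (R : realType) (n : nat) (w : 'I_n -> R) (D : 'M[R]_n)
    (u : 'cV[R]_n) (k : 'I_n) :
  (weighted_diff w D *m u) k 0 = w k * (D *m u) k 0.
Proof.
by rewrite !mxE mulr_sumr; apply: eq_bigr => l _; rewrite !mxE mulrA.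
Qed.

Definition weighted_laplacian (R : realType) (n : nat) (Dx Dy : 'M[R]_n)
    (wx wy : 'I_n -> R) : 'M[R]_n :=
  - ((weighted_diff wx Dx)^T *m weighted_diff wx Dx +
     (weighted_diff wy Dy)^T *m weighted_diff wy Dy).

(* Main.v *)
(* The bound on theta says that q := beta theta ||Delta^w||_oo < 1, and q bounds
   the absolute row sums of F. So F is a q-contraction of row vectors for the
   1-norm, which bounds the eigenvalues and excludes 1, and of column vectors
   for the sup norm, which gives the convergence. *)
Require Import Defs.
From mathcomp Require Import all_boot all_order all_algebra.
From mathcomp Require Import complex.
From mathcomp Require Import all_classical all_reals all_analysis.

Set Implicit Arguments.
Unset Strict Implicit.
Unset Printing Implicit Defensive.

Import Order.TTheory GRing.Theory Num.Theory.
Import numFieldNormedType.Exports.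

Local Open Scope classical_set_scope.
Local Open Scope ring_scope.

(** After exchanging the two sums, each [|v 0 i|] is weighted by the absolute sum of row [i] of
    [F]. *)
Lemma l1norm_mulmx_le (K : numDomainType) (n : nat) (F : 'M[K]_n) (q : K)
    (v : 'rV[K]_n) : (forall i, \sum_j `|F i j| <= q) ->
  \sum_j `|(v *m F) 0 j| <= q * \sum_i `|v 0 i|.
Proof.
move=> Fq; apply: (@le_trans _ _ (\sum_j \sum_i `|v 0 i| * `|F i j|)).
  apply: ler_sum => j _; rewrite mxE (le_trans (ler_norm_sum _ _ _))//.
  by apply: ler_sum => i _; rewrite normrM.
rewrite exchange_big mulr_sumr; apply: ler_sum => i _.
by rewrite -mulr_sumr mulrC ler_wpM2r.
Qed.

(* [eigenvalue] refers to left eigenvectors (v *m F = z *: v), hence the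
   1-norm of v rather than its sup norm. *)
Lemma eigenvalue_norm_le (K : numFieldType) (n : nat) (F : 'M[K]_n) (q z : K) :
  (forall i, \sum_j `|F i j| <= q) -> eigenvalue F z -> `|z| <= q.
Proof.
move=> Fq /eigenvalueP[v vF v0].
have := l1norm_mulmx_le v Fq; rewrite vF.
under eq_bigr do rewrite mxE normrM.
(* Cancel the 1-norm of [v], which is positive because [v] is nonzero. *)
rewrite -mulr_sumr ler_pM2r// lt_def sumr_ge0// andbT.
apply: contra v0; rewrite psumr_eq0// => /allP v0.
apply/eqP/rowP => j; rewrite mxE; apply/eqP.
by rewrite -normr_eq0 (implyP (v0 j (mem_index_enum j))).
Qed.

Section row_sum_contraction.
Variables (R : realType) (n : nat) (F : 'M[R]_n) (q : R).
Hypotheses (q1 : q < 1) (Fq : forall i, \sum_j `|F i j| <= q).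

Lemma spectral_radius_lt1 : spectral_radius F < 1.
Proof.
rewrite /spectral_radius; set S := [set _ | _ in _].
(* The spectrum over [R[i]] is empty only for [n = 0]; the default [sup set0 = 0] settles that
   case. *)
have [->|S0] := eqVneq S set0; first by rewrite sup0.
apply: le_lt_trans q1; apply: ge_sup; first exact/set0P.
(* The norm on [R[i]] takes values in [R[i]], with zero imaginary part, so the comparison is carried
   out there. *)
move=> _ [z /= Fz <-]; rewrite -lecR.
have -> : ((complex.Re `|z|)%:C = `|z|)%C by rewrite normc_def.
apply: eigenvalue_norm_le Fz => i.
under eq_bigr do rewrite mxE normc_def /= expr0n addr0 sqrtr_sqr.
by rewrite -rmorph_sum lecR.
Qed.

(** A nonzero row vector in the kernel would be an eigenvector of [F] for the eigenvalue 1, whose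
    modulus exceeds [q]. *)
Lemma sub1mx_unit : 1%:M - F \in unitmx.
Proof.
rewrite -row_free_unit -kermx_eq0; apply/rowV0P => v /sub_kermxP.
rewrite mulmxBr mulmx1 => /subr0_eq vF; apply/eqP/negPn/negP => v0.
have /(eigenvalue_norm_le Fq) : eigenvalue F 1.
  by apply/eigenvalueP; exists v => //; rewrite -vF scale1r.
by rewrite normr1 leNgt q1.
Qed.

Hypothesis q0 : 0 <= q.

Lemma mulmx_norm_le (v : 'cV[R]_n) : `|F *m v| <= q * `|v|.
Proof.
rewrite [leLHS]mx_normrE; apply: bigmax_le => [|[i j] _ /=].
  by rewrite mulr_ge0.
rewrite mxE (le_trans (ler_norm_sum _ _ _))//.
apply: le_trans (ler_wpM2r (normr_ge0 v) (Fq i)).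
rewrite mulr_suml; apply: ler_sum => k _; rewrite normrM ler_wpM2l//.
rewrite [leRHS]mx_normrE.
exact: (le_bigmax _ (fun ij => `|v ij.1 ij.2|) (k, j)).
Qed.

(** Subtracting the fixed-point equation cancels [B]: the error is multiplied by [F] at each step,
    so its sup norm decays at least like [q ^+ m]. *)
Lemma fixpoint_iteration_cvg (X : nat -> 'cV[R]_n) (B Y : 'cV[R]_n) :
  (forall m, X m.+1 = F *m X m + B) -> Y = F *m Y + B ->
  X m @[m --> \oo] --> Y.
Proof.
move=> XE YE; apply/subr_cvg0; apply: norm_cvg0.
have dist m : `|X m - Y| <= `|X 0%N - Y| * q ^+ m.
  elim: m => [|m IHm]; first by rewrite expr0 mulr1.
  rewrite XE {1}YE opprD addrACA subrr addr0 -mulmxBr.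
  by rewrite (le_trans (mulmx_norm_le _))// exprS mulrCA ler_wpM2l.
have nearb : \forall m \near \oo,
    cst 0 m <= `|X m - Y| <= geometric `|X 0%N - Y| q m.
  by apply: nearW => m /=; rewrite normr_ge0 dist.
apply: (squeeze_cvgr nearb); first exact: cvg_cst.
by apply: cvg_geometric; rewrite ger0_norm.
Qed.

End row_sum_contraction.

Lemma row_sum_le_mxnorm_inf (R : realType) (n : nat) (A : 'M[R]_n) (i : 'I_n) :
  \sum_j `|A i j| <= mxnorm_inf A.
Proof. exact: (le_bigmax _ (fun i => \sum_j `|A i j|)). Qed.

Theorem theorem3p1 (R : realType) (N : nat) (hN : (2 <= N)%N)
    (Dx Dy : 'M[R]_(N ^ 2)) (hD : discrete_gradient Dx Dy)
    (wx wy : 'I_(N ^ 2) -> R) (hw : admissible_weights Dx Dy wx wy)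
    (Deltaw : 'M[R]_(N ^ 2)) (hDelta : Deltaw = weighted_laplacian Dx Dy wx wy)
    (beta : R) (hbeta : 0 < beta)
    (theta : R) (htheta0 : 0 < theta)
    (htheta : theta < 1 / (beta * mxnorm_inf Deltaw))
    (A E F : 'M[R]_(N ^ 2))
    (hA : A = 1%:M - (beta * theta) *: Deltaw)
    (hE : E = 1%:M)
    (hF : F = (beta * theta) *: Deltaw) :
  spectral_radius (invmx E *m F) < 1 /\
  forall B : 'cV[R]_(N ^ 2),
    exists Xsol : 'cV[R]_(N ^ 2),
      [/\ A *m Xsol = B,
          forall Y : 'cV[R]_(N ^ 2), A *m Y = B -> Y = Xsol &
          forall X : nat -> 'cV[R]_(N ^ 2),
            (forall m : nat, X m.+1 = F *m X m + B) ->
            X m @[m --> \oo] --> Xsol].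
Proof.
have c0 : 0 < beta * theta by rewrite mulr_gt0.
(* The inverse of [beta * mxnorm_inf Deltaw] exceeds [theta > 0]; since [0^-1 = 0], this rules out a
   zero norm. *)
have D0 : 0 < mxnorm_inf Deltaw.
  have := lt_trans htheta0 htheta.
  by rewrite div1r invr_gt0 pmulr_rgt0.
have q1 : beta * theta * mxnorm_inf Deltaw < 1.
  by move: htheta; rewrite ltr_pdivlMr ?mulr_gt0// mulrA [theta * _]mulrC.
have Fq i : \sum_j `|F i j| <= beta * theta * mxnorm_inf Deltaw.
  rewrite hF; under eq_bigr do rewrite mxE normrM (gtr0_norm c0).
  by rewrite -mulr_sumr ler_pM2l// row_sum_le_mxnorm_inf.
have Au : A \in unitmx by rewrite hA -hF; exact: sub1mx_unit q1 Fq.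
split=> [|B]; first by rewrite hE invmx1 mul1mx; exact: spectral_radius_lt1 q1 Fq.
exists (invmx A *m B); split=> [|Y <-|X HX]; first by rewrite mulKVmx.
  by rewrite mulKmx.
apply: fixpoint_iteration_cvg q1 Fq _ _ _ _ HX _.
  by rewrite mulr_ge0// ltW.
(* With [A = 1 - F], solving the system amounts to being a fixed point of the iteration. *)
have : A *m (invmx A *m B) = B by rewrite mulKVmx.
by rewrite {1}hA -hF mulmxBl mul1mx => /eqP; rewrite subr_eq addrC => /eqP.
Qed.
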